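(* Let $\{f_n\}_{n\ge 0}$ (with $f_0=1$), $\{g_n\}_{n\ge 1}$ and $\{h_n\}_{n\ge 1}$ be sequences of complex numbers with $g_n\neq 0$ for all $n\ge 1$. Put $H_0/G_0=1$ and, for $j\ge 1$, $H_j=h_1\cdots h_j$, $G_j=g_1\cdots g_j$. Then the following statements are equivalent. (i) As formal power series in $x$, $$\sum_{n=0}^\infty f_n x^n=\left(\sum_{j=0}^\infty\frac{H_j}{G_j}x^j\right)^{-1}=1-\cfrac{h_1 x}{g_1+h_1 x-\cfrac{g_1 h_2 x}{g_2+h_2 x-\cfrac{g_2h_3 x}{g_3+h_3 x-\ddots}}}.$$ (ii) For all $n\ge 1$, $\displaystyle f_n=(-1)^n D_n\!\left(\frac{H_1}{G_1},\dots,\frac{H_n}{G_n}\right)$. (iii) $\displaystyle \sum_{k=0}^n f_k\frac{H_{n-k}}{G_{n-k}}=1$ if $n=0$, and $=0$ for all $n\ge 1$. (iv) For all $n\ge 1$, $\displaystyle \frac{H_n}{G_n}=(-1)^n D_n(f_1,\dots,f_n)$. (v) For all $n\ge 1$, $$f_n=\sum_{t_1+2t_2+\cdots+nt_n=n}\binom{t_1+\cdots+t_n}{t_1,\dots,t_n}(-1)^{t_1+\cdots+t_n}\left(\frac{H_1}{G_1}\right)^{t_1}\cdots\left(\frac{H_n}{G_n}\right)^{t_n}=\sum_{k=1}^n(-1)^k\sum_{\substack{i_1+\cdots+i_k=n\\ i_1,\dots,i_k\ge 1}}\frac{H_{i_1}}{G_{i_1}}\cdots\frac{H_{i_k}}{G_{i_k}}.$$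 (vi) For all $n\ge 1$, $$\frac{H_n}{G_n}=\sum_{t_1+2t_2+\cdots+nt_n=n}\binom{t_1+\cdots+t_n}{t_1,\dots,t_n}(-1)^{t_1+\cdots+t_n}f_1^{t_1}\cdots f_n^{t_n}=\sum_{k=1}^n(-1)^k\sum_{\substack{i_1+\cdots+i_k=n\\ i_1,\dots,i_k\ge 1}}f_{i_1}\cdots f_{i_k}.$$
   Context: For numbers $a_1,\dots,a_n$, $D_n(a_1,\dots,a_n)$ denotes the determinant of the $n\times n$ Toeplitz--Hessenberg matrix whose $(i,j)$ entry is $a_{i-j+1}$ if $i\ge j$, is $1$ if $j=i+1$, and is $0$ if $j>i+1$: $$D_n(a_1,\dots,a_n)=\begin{vmatrix} a_1&1&0&&\\ a_2&a_1&1&&\\ \vdots&\vdots&\ddots&&0\\ a_{n-1}&a_{n-2}&\cdots&a_1&1\\ a_n&a_{n-1}&\cdots&a_2&a_1\end{vmatrix}.$$ In the sums indexed by $t_1+2t_2+\cdots+nt_n=n$ the $t_i$ are nonnegative integers, and $\binom{t_1+\cdots+t_n}{t_1,\dots,t_n}=\frac{(t_1+\cdots+t_n)!}{t_1!\cdots t_n!}$. The $i_j$ are positive integers. The infinite continued fraction is the limit, in the $x$-adic topology on formal power series, of its finite truncations (convergents), the $n$-th one ending with the partial denominator $g_n+h_nx$; each truncation is a rational function of $x$ expanded as a formal power series at $x=0$. *)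

(* Defs.v *)
From HB Require Import structures.
From mathcomp Require Import all_boot all_order all_algebra.
From mathcomp Require Export complex.
From mathcomp Require Export boolp filter reals.

Set Implicit Arguments.
Unset Strict Implicit.
Unset Printing Implicit Defensive.

Import GRing.Theory.
Local Open Scope ring_scope.
Local Open Scope classical_set_scope.

Local Notation "p %:F" := (FracField.tofrac p).

(* The ring F[[x]]. A record rather than a bare function type, so that the
   product is the Cauchy product and not a pointwise one. *)
Record fps (F : fieldType) : Type := FPS { fps_coef :> nat -> F }.

HB.instance Definition _ (F : fieldType) := gen_eqMixin (fps F).
HB.instance Definition _ (F : fieldType) := gen_choiceMixin (fps F).

Section FormalPowerSeries.
Variable F : fieldType.
Implicit Types (a b c : fps F) (n k : nat).

Lemma fpsP a b : (forall n, a n = b n) <-> a = b.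
Proof.
split=> [|-> //]; case: a b => [a] [b] /= eq_ab.
by congr FPS; apply/funext.
Qed.

Definition fps_zero : fps F := FPS (fun=> 0).
Definition fps_opp a : fps F := FPS (fun n => - a n).
Definition fps_add a b : fps F := FPS (fun n => a n + b n).

Fact fps_addA : associative fps_add.
Proof. by move=> a b c; apply/fpsP => n /=; rewrite addrA. Qed.
Fact fps_addC : commutative fps_add.
Proof. by move=> a b; apply/fpsP => n /=; rewrite addrC. Qed.
Fact fps_add0 : left_id fps_zero fps_add.
Proof. by move=> a; apply/fpsP => n /=; rewrite add0r. Qed.
Fact fps_addN : left_inverse fps_zero fps_opp fps_add.
Proof. by move=> a; apply/fpsP => n /=; rewrite addNr. Qed.

HB.instance Definition _ :=
  GRing.isZmodule.Build (fps F) fps_addA fps_addC fps_add0 fps_addN.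

Definition fps_of_poly (p : {poly F}) : fps F := FPS (fun n => p`_n).
Definition fps_mul a b : fps F :=
  FPS (fun n => \sum_(k < n.+1) a k * b (n - k)%N).

Let trunc n a : {poly F} := \poly_(i < n.+1) a i.

Let coef_fps_mul n m a b : (m <= n)%N ->
  (fps_mul a b) m = (trunc n a * trunc n b)`_m.
Proof.
move=> le_mn; rewrite coefM; apply: eq_bigr => i _.
rewrite /trunc !coef_poly !ltnS (leq_trans (leq_ord i) le_mn).
by rewrite (leq_trans (leq_subr _ _) le_mn).
Qed.

Fact fps_mulC : commutative fps_mul.
Proof. by move=> a b; apply/fpsP => n; rewrite !(@coef_fps_mul n) // mulrC. Qed.

Fact fps_mulA : associative fps_mul.
Proof.
move=> a b c; apply/fpsP => n.
transitivity ((trunc n a * (trunc n b * trunc n c))`_n).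
  rewrite coefM; apply: eq_bigr => i _ /=.
  rewrite /trunc coef_poly ltnS leq_ord; congr (_ * _).
  exact: coef_fps_mul (leq_subr _ _).
rewrite mulrA coefM; apply: eq_bigr => i _ /=.
rewrite [(trunc n c)`_(n - i)]coef_poly ltnS leq_subr; congr (_ * _).
by apply/esym/coef_fps_mul; exact: leq_ord.
Qed.

Fact fps_mul1 : left_id (fps_of_poly 1) fps_mul.
Proof.
move=> a; apply/fpsP => n /=.
rewrite big_ord_recl /= coef1 eqxx mul1r subn0 big1 ?addr0 // => i _.
by rewrite coef1 mul0r.
Qed.

Fact fps_mulDl : left_distributive fps_mul fps_add.
Proof.
move=> a b c; apply/fpsP => n /=; rewrite -big_split /=.
by apply: eq_bigr => i _; rewrite mulrDl.
Qed.

Fact fps_one_neq0 : fps_of_poly 1 != 0 :> fps F.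
Proof.
by apply/eqP => /fpsP /(_ 0%N) /eqP; rewrite /= coef1 /= oner_eq0.
Qed.

HB.instance Definition _ := GRing.Zmodule_isComNzRing.Build (fps F)
  fps_mulA fps_mulC fps_mul1 fps_mulDl fps_one_neq0.

Definition fps_unit : pred (fps F) := fun a => a 0%N != 0.

(* a^-1 = (1/a_0) * \sum_k (1 - a/a_0)^k; the k-th power has no term of degree
   less than k, so each coefficient is a finite sum. *)
Definition fps_inv a : fps F :=
  if fps_unit a then
    FPS (fun n => (a 0%N)^-1 *
           \sum_(k < n.+1) ((1 - fps_of_poly ((a 0%N)^-1%:P) * a) ^+ k) n)
  else a.

Let coef_sum (I : Type) (r : seq I) (P : pred I) (G : I -> fps F) n :
  (\sum_(i <- r | P i) G i) n = \sum_(i <- r | P i) (G i n).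
Proof. by elim/big_rec2: _ => //= i x y _ <-. Qed.

Let coef_mul a b n : (a * b) n = \sum_(k < n.+1) a k * b (n - k)%N.
Proof. by []. Qed.

Let coefCM x a n : (fps_of_poly x%:P * a) n = x * a n.
Proof.
rewrite /= big_ord_recl /= coefC eqxx subn0 big1 ?addr0 // => i _.
by rewrite coefC mul0r.
Qed.

Let coef_exp_small (u : fps F) k n : u 0%N = 0 -> (n < k)%N -> (u ^+ k) n = 0.
Proof.
move=> u0; elim: k n => // k IHk n; rewrite ltnS => le_nk.
rewrite exprS /= big1 // => -[[|i] /= lt_in] _; first by rewrite u0 mul0r.
rewrite IHk ?mulr0 //; case: n le_nk lt_in => // n lt_nk _.
by rewrite subSS (leq_ltn_trans (leq_subr _ _)).
Qed.

Fact fps_mulVr : {in fps_unit, left_inverse 1 fps_inv *%R}.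
Proof.
move=> a ua; have a0 : a 0%N != 0 by exact: ua.
rewrite /fps_inv; have -> : fps_unit a by exact: ua.
set x := (a 0%N)^-1; pose u : fps F := 1 - fps_of_poly x%:P * a.
have u0 : u 0%N = 0.
  rewrite [LHS]/= -[X in _ - X]/((fps_of_poly x%:P * a) 0%N) coefCM coef1.
  by rewrite mulVf ?subrr.
apply/fpsP => n.
transitivity (((\sum_(k < n.+1) u ^+ k) * (fps_of_poly x%:P * a)) n).
  rewrite [in RHS]mulrCA coefCM !coef_mul mulr_sumr.
  apply: eq_bigr => i _; rewrite mulrA coef_sum /=; congr (_ * _ * _).
  rewrite -!(big_mkord xpredT (fun k => (u ^+ k) i)).
  rewrite [RHS](big_cat_nat (n := i.+1)) //= [X in _ + X]big_nat_cond.
  rewrite [X in _ + X]big1 ?addr0 // => k /andP[/andP[lt_ik _] _].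
  exact: coef_exp_small.
have -> : fps_of_poly x%:P * a = 1 - u by rewrite /u opprB addrCA subrr addr0.
have -> : (\sum_(k < n.+1) u ^+ k) * (1 - u) = 1 - u ^+ n.+1.
  by rewrite mulrC -opprB mulNr -subrX1 opprB.
by rewrite [LHS]/= -[X in _ - X]/((u ^+ n.+1) n) coef_exp_small ?subr0.
Qed.

Fact fps_unitPl a b : b * a = 1 -> fps_unit a.
Proof.
move/fpsP/(_ 0%N); rewrite [LHS]big_ord1 subn0 /= coef1 => ba1.
by apply/eqP => a0; move/eqP: ba1; rewrite a0 mulr0 eq_sym oner_eq0.
Qed.

Fact fps_inv_out : {in [predC fps_unit], fps_inv =1 id}.
Proof.
move=> a ua; have /negbTE a_nunit : ~~ fps_unit a by exact: ua.
by rewrite /fps_inv a_nunit.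
Qed.

HB.instance Definition _ := GRing.ComNzRing_hasMulInverse.Build (fps F)
  fps_mulVr fps_unitPl fps_inv_out.

(* Convergence in the x-adic topology: for every N the difference eventually
   lies in the ideal generated by x^N. *)
Definition xadic_cvg (s : nat -> fps F) (l : fps F) : Prop :=
  forall N, \forall n \near \oo, exists q : fps F,
    s n - l = fps_of_poly 'X^N * q.

(* a is the expansion at x = 0 of the rational function r. *)
Definition fps_expansion (r : {fraction {poly F}}) a : Prop :=
  exists p q : {poly F},
    [/\ q.[0] != 0, r = p%:F / q%:F & a = fps_of_poly p / fps_of_poly q].

End FormalPowerSeries.

Section ToeplitzHessenberg.
Variable F : fieldType.
Implicit Types (a f g h : nat -> F) (n k m : nat).

(* Sequences are indexed from 1 below; the entry at 0 is never used. *)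

Definition prefix_prod a n : F := \prod_(1 <= i < n.+1) a i.

(* Rows and columns are numbered from 0 here, which leaves i - j unchanged. *)
Definition toeplitz_hessenberg n a : 'M[F]_n :=
  \matrix_(i < n, j < n)
    if (j <= i)%N then a (i - j).+1 else if j == i.+1 :> nat then 1 else 0.

Definition TH_det n a : F := \det (toeplitz_hessenberg n a).

(* The coordinate t i stands for t_(i+1); the bound t_i <= n built into the
   type of t is implied by t_1 + 2 t_2 + ... + n t_n = n.
   The quotient of factorials is taken in F, which should have
   characteristic 0. *)
Definition multinomial_sum n a : F :=
  \sum_(t : {ffun 'I_n -> 'I_n.+1} | (\sum_(i < n) i.+1 * t i)%N == n)
    ((\sum_(i < n) t i)%N`!%:R / (\prod_(i < n) (t i)`!)%N%:R)
    * (-1) ^+ (\sum_(i < n) t i)%N * \prod_(i < n) a i.+1 ^+ t i.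

(* The bound i_j <= n built into the type of the composition c is implied by
   i_1 + ... + i_k = n. *)
Definition composition_sum n a : F :=
  \sum_(1 <= k < n.+1) (-1) ^+ k *
    \sum_(c : {ffun 'I_k -> 'I_n.+1} |
            ((\sum_(j < k) c j)%N == n) && [forall j, (0 < c j)%N])
      \prod_(j < k) a (c j).

Definition partial_denominator g h k : {fraction {poly F}} :=
  ((g k)%:P + h k *: 'X)%:F.

(* g_k + h_k x - g_k h_(k+1) x / (g_(k+1) + h_(k+1) x - ... ), with m further
   levels, the last one being g_(k+m) + h_(k+m) x. *)
Fixpoint cf_tail g h k m : {fraction {poly F}} :=
  if m is m'.+1 then
    partial_denominator g h k
      - ((g k * h k.+1) *: 'X)%:F / cf_tail g h k.+1 m'
  else partial_denominator g h k.

(* The n-th truncation (n >= 1), ending with g_n + h_n x. *)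
Definition cf_truncation g h n : {fraction {poly F}} :=
  1 - (h 1%N *: 'X)%:F / cf_tail g h 1 n.-1.

Definition cf_value g h (s : fps F) : Prop :=
  exists2 c : nat -> fps F,
    forall n, (1 <= n)%N -> fps_expansion (cf_truncation g h n) (c n)
    & xadic_cvg c s.

End ToeplitzHessenberg.

(* Main.v *)
Require Import Defs.
From mathcomp Require Import all_boot all_order all_algebra.
Import GRing.Theory.
Local Open Scope ring_scope.

(** All six conditions say that the series f = sum f_n x^n and
u = sum (H_n / G_n) x^n, which both have constant term 1, are inverse to each
other. This is a symmetric relation, which explains the pairs (ii)-(iv) and
(v)-(vi); condition (iii) spells out f u = 1 coefficient by coefficient. So it
is enough to compute the inverse of a series a with a_0 = 1 in three ways.

- As a determinant (fps_inv_TH_det). The equations expressing that b is inverse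
  to a form a linear system whose matrix is the Toeplitz-Hessenberg matrix of a;
  Cramer's rule reads b_n off its determinant.

- As a sum over compositions (fps_inv_composition). Write a = 1 + p; the inverse
  is the geometric series of the (- p)^k, and the coefficient of x^n in p^k is
  a sum over the compositions of n into k parts.

- As a multinomial sum (multinomial_composition). The multinomial theorem
  expands the same powers p^k by the numbers t_i of parts equal to i. That
  theorem (multinomial_theorem) follows from the multiplicativity of the
  exponential series, which is where characteristic 0 enters.

The continued fraction in (i) always represents the inverse of u, whatever f
is: Euler's identity (cf_tailE, cf_truncationE) says that its n-th truncation is
exactly the inverse of the n-th partial sum of u, and these partial sums
converge to u (cf_value_inv). *)

Set Implicit Arguments.
Unset Strict Implicit.
Unset Printing Implicit Defensive.

Local Notation "p %:F" := (FracField.tofrac p).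

(** * Formal power series and their inverses *)

Lemma fps_coefM (F : fieldType) (a b : fps F) n :
  (a * b) n = \sum_(k < n.+1) a k * b (n - k)%N.
Proof. by []. Qed.

Lemma fps_unitE (F : fieldType) (a : fps F) :
  (a \is a GRing.unit) = (a 0%N != 0).
Proof. by []. Qed.

Lemma fps_of_polyM (F : fieldType) (p q : {poly F}) :
  fps_of_poly (p * q) = fps_of_poly p * fps_of_poly q.
Proof. by apply/fpsP => n; rewrite [LHS]coefM. Qed.

Lemma fps_of_polyX (F : fieldType) (p : {poly F}) k :
  fps_of_poly (p ^+ k) = fps_of_poly p ^+ k.
Proof. by elim: k => // k IHk; rewrite !exprS fps_of_polyM IHk. Qed.

(** Truncating a series lets its powers be computed with polynomials. *)
Lemma fps_exp_trunc (F : fieldType) (a b : fps F) n k i :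
  (forall j, (j <= n)%N -> a j = b j) -> (i <= n)%N -> (a ^+ k) i = (b ^+ k) i.
Proof.
move=> eq_ab; elim: k i => // k IHk i le_in; rewrite !exprS !fps_coefM.
apply: eq_bigr => j _; rewrite eq_ab ?IHk //.
  exact: leq_trans (leq_subr _ _) le_in.
exact: leq_trans (leq_ord j) le_in.
Qed.

Lemma fps_invP (F : fieldType) (a b : nat -> F) : a 0%N = 1 ->
  (FPS b = (FPS a)^-1) <->
  (forall n, \sum_(k < n.+1) b k * a (n - k)%N = if n == 0%N then 1 else 0).
Proof.
move=> a0; have Ua : FPS a \is a GRing.unit by rewrite fps_unitE /= a0 oner_eq0.
have eq1 n : (1 : fps F) n = if n == 0%N then 1 else 0.
  by rewrite [LHS]coef1; case: n.
split=> [eq_b n|ba1].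
  by rewrite -eq1 -(mulVr Ua) -eq_b.
apply: (mulIr Ua); rewrite mulVr //; apply/fpsP=> n.
by rewrite fps_coefM eq1 ba1.
Qed.

Lemma fps_inv_sym (F : fieldType) (a b : fps F) : a = b^-1 <-> b = a^-1.
Proof. by split=> ->; rewrite invrK. Qed.

(** The form in which a formula e for the coefficients of the inverse is turned
into an equivalence; the constant terms agree because both are 1. *)
Lemma fps_eq_invP (F : fieldType) (a b e : nat -> F) :
  a 0%N = 1 -> b 0%N = 1 ->
  (forall n, (1 <= n)%N -> (FPS a)^-1 n = e n) ->
  FPS b = (FPS a)^-1 <-> (forall n, (1 <= n)%N -> b n = e n).
Proof.
move=> a0 b0 inv_e; have inv0 : (FPS a)^-1 0%N = 1.
  case: (fps_invP (FPS a)^-1 a0) => + _ => /(_ _ 0%N).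
  by rewrite big_ord1 /= a0 mulr1; apply; apply/fpsP.
rewrite -fpsP; split=> [eq_b n n_gt0|eq_b [|n]].
- by rewrite -inv_e // -eq_b.
- by rewrite inv0.
- by rewrite inv_e // -eq_b.
Qed.

(** * The inverse as a sum over compositions *)

Definition pos_poly (F : fieldType) n (a : nat -> F) : {poly F} :=
  \sum_(i < n) a i.+1 *: 'X^(i.+1).

Lemma coef_pos_poly (F : fieldType) n (a : nat -> F) j :
  (j <= n)%N -> (pos_poly n a)`_j = if j is 0%N then 0 else a j.
Proof.
move=> le_jn; rewrite coef_sum; case: j le_jn => [|j] lt_jn.
  by rewrite big1 // => i _; rewrite coefZ coefXn mulr0.
rewrite (bigD1 (Ordinal lt_jn)) //= coefZ coefXn eqxx mulr1 big1 ?addr0 // => i.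
by rewrite -val_eqE /= coefZ coefXn eqSS eq_sym => /negbTE->; rewrite mulr0.
Qed.

(** The geometric series of 1 - a, cut off after the n-th power: 1 - a has no
constant term, so its k-th power starts in degree k. *)
Lemma fps_inv_coef (F : fieldType) (a : nat -> F) n : a 0%N = 1 ->
  (FPS a)^-1 n = \sum_(k < n.+1) (-1) ^+ k * (pos_poly n a ^+ k)`_n.
Proof.
move=> a0; rewrite [LHS]/(fps_inv _ n) /fps_inv /fps_unit /= a0 oner_eq0 /=.
rewrite invr1 mul1r mul1r; apply: eq_bigr => k _.
transitivity ((fps_of_poly (- pos_poly n a) ^+ k) n); last first.
  rewrite -fps_of_polyX /= [in LHS]exprNn.
  rewrite -(signr_odd {poly F} k) -(signr_odd F k).
  by rewrite !mulr_sign; case: odd; rewrite ?coefN.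
apply: (@fps_exp_trunc _ _ _ n) => // j le_jn.
transitivity ((1 : {poly F})`_j - a j) => //.
rewrite coef1 [RHS]coefN coef_pos_poly //.
by case: j le_jn => [|j] _; rewrite ?a0 ?subrr ?oppr0 ?sub0r.
Qed.

(** Choosing one monomial in each of the k factors of the power is choosing a
sequence of k positive exponents; the choices of total degree n are the
compositions of n into k parts. *)
Lemma composition_sumE (F : fieldType) (a : nat -> F) n : (1 <= n)%N ->
  composition_sum n a = \sum_(k < n.+1) (-1) ^+ k * (pos_poly n a ^+ k)`_n.
Proof.
(* The term k = 0 on the right is the coefficient of 'X^n in 1. *)
move=> n_gt0; rewrite [RHS]big_ord_recl /= coef1 gtn_eqF // mulr0 add0r.
rewrite /composition_sum big_add1 big_mkord; apply: eq_bigr => k _.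
rewrite /bump leq0n add1n; congr (_ * _).
have -> : pos_poly n a = \sum_(i < n.+1 | (0 < i)%N) a i *: 'X^i.
  by rewrite /pos_poly [RHS]big_mkcond [RHS]big_ord_recl /= add0r.
rewrite -[in RHS](card_ord k.+1) -prodr_const bigA_distr_big coef_sum.
rewrite [RHS]big_mkcond [LHS]big_mkcond; apply: eq_bigr => c _.
rewrite scaler_prod -(big_morph _ (exprD 'X) (expr0 'X)) coefZ coefXn eq_sym.
have -> : (c \in ffun_on (fun i : 'I_n.+1 => (0 < i)%N))
    = [forall j, (0 < c j)%N].
  by apply/ffun_onP/forallP.
by case: forallP; case: eqP; rewrite ?mulr1 ?mulr0.
Qed.

Lemma fps_inv_composition (F : fieldType) (a : nat -> F) n : a 0%N = 1 ->
  (1 <= n)%N -> (FPS a)^-1 n = composition_sum n a.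
Proof. by move=> a0 n_gt0; rewrite composition_sumE // fps_inv_coef. Qed.

(** * The inverse as a Toeplitz-Hessenberg determinant *)

(** Cramer's rule. Put b for the inverse series and M for the matrix. For a row
i < n - 1 the i-th entry of M (b_0, ..., b_(n-1)) is the coefficient of degree
i + 1 of a b = 1, which is 0: the superdiagonal ones play the part of a_0 = 1.
The last row lacks only the term b_n, so M b = - b_n e_(n-1). Multiplying by
the adjugate and reading the first coordinate, where b_0 = 1, gives det M as
- b_n times a cofactor; its minor is triangular with ones on the diagonal. *)
Lemma TH_det_inv (F : fieldType) (a : nat -> F) n : a 0%N = 1 ->
  TH_det n a = (-1) ^+ n * (FPS a)^-1 n.
Proof.
move=> a0; pose b : nat -> F := (FPS a)^-1.
have /(fps_invP b a0) ba1 : FPS b = (FPS a)^-1 by apply/fpsP.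
rewrite -/(b n).
have b0 : b 0%N = 1 by have := ba1 0%N; rewrite big_ord1 a0 mulr1.
case: n => [|m]; first by rewrite /TH_det det_mx00 b0 mulr1.
pose M := toeplitz_hessenberg m.+1 a; pose v := \col_(j < m.+1) b j.
have Mv : M *m v = - b m.+1 *: delta_mx ord_max 0.
  apply/colP => i; rewrite !mxE.
  (* Row i of M, extended by the column m + 1, is a_(i+1), ..., a_1, a_0 padded
     with zeros. *)
  have : \sum_(j < m.+2)
           b j * (if (j <= i.+1)%N then a (i.+1 - j)%N else 0) = 0.
    have := ba1 i.+1.
    rewrite (big_ord_widen m.+2 (fun k => b k * a (i.+1 - k)%N)); last first.
      by rewrite !ltnS leq_ord.
    move=> /= eq0; rewrite -[RHS]eq0 [RHS]big_mkcond; apply: eq_bigr => j _.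
    by rewrite ltnS; case: ifP; rewrite ?mulr0.
  rewrite big_ord_recr /= => /eqP; rewrite addr_eq0 => /eqP eq_bm.
  transitivity (- (b m.+1 * (if (m <= i)%N then a (i - m)%N else 0))).
    rewrite -eq_bm; apply: eq_bigr => j _; rewrite !mxE mulrC; congr (_ * _).
    case: (leqP j i) => [le_ji|lt_ij]; first by rewrite leqW // subSn.
    rewrite eqn_leq lt_ij andbT; case: ifP => // le_j.
    by have /eqP-> : (j == i.+1 :> nat); [rewrite eqn_leq le_j | rewrite subnn].
  rewrite mulNr andbT; congr (- (_ * _)); rewrite -val_eqE /=.
  have [->|i_neq] := eqVneq (i : nat) m; first by rewrite leqnn subnn a0.
  case: leqP => // le_mi; case/eqP: i_neq.
  by apply/eqP; rewrite eqn_leq le_mi -ltnS ltn_ord.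
have det_minor : \det (row' ord_max (col' 0 M)) = 1.
  rewrite det_trig; first rewrite big1 // => i _.
    by rewrite !mxE lift_max lift0 ltnn eqxx.
  apply/is_trig_mxP => i j lt_ij; rewrite !mxE lift_max lift0.
  by rewrite ltnNge ltnW // eqSS gtn_eqF.
have := congr1 (fun w : 'cV_m.+1 => w 0 0) (congr1 (mulmx (\adj M)) Mv).
rewrite mulmxA mul_adj_mx mul_scalar_mx -scalemxAr -colE !mxE b0 mulr1.
rewrite /TH_det -/M => ->; rewrite /cofactor det_minor mulr1 addn0 /=.
by rewrite mulrC exprS mulN1r mulNr mulrN.
Qed.

Lemma fps_inv_TH_det (F : fieldType) (a : nat -> F) n : a 0%N = 1 ->
  (FPS a)^-1 n = (-1) ^+ n * TH_det n a.
Proof.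
by move=> a0; rewrite TH_det_inv // mulrA -exprMn mulrNN mulr1 expr1n mul1r.
Qed.

(** * The multinomial theorem and multinomial sums *)

(** The binomial theorem for the divided powers x^k / k!, which carries no
coefficients; this is what makes exponential series multiplicative. *)
Lemma divided_powerD (F : fieldType) (A : comAlgType F) (x y : A) k :
  [pchar F] =i pred0 ->
  (k`!%:R : F)^-1 *: (x + y) ^+ k =
  \sum_(i < k.+1)
    ((i`!%:R : F)^-1 *: x ^+ i) * (((k - i)`!%:R : F)^-1 *: y ^+ (k - i)).
Proof.
move=> /pcharf0P F0; have nat_neq0 m : (0 < m)%N -> (m%:R : F) != 0.
  by rewrite F0 -lt0n.
rewrite addrC exprDn scaler_sumr; apply: eq_bigr => i _.
rewrite -scalerAl -scalerAr scalerA [y ^+ _ * _]mulrC -scaler_nat scalerA.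
congr (_ *: _); have le_ik : (i <= k)%N by rewrite -ltnS.
rewrite -(bin_fact le_ik) !natrM invfM mulrAC mulVf ?mul1r ?invfM //.
by rewrite nat_neq0 ?bin_gt0.
Qed.

(** The exponential series exp (x Z), truncated after degree N in Z. *)
Definition divided_exp (F : fieldType) (A : comAlgType F) N (x : A) :
    {poly A} :=
  \poly_(k < N.+1) ((k`!%:R : F)^-1 *: x ^+ k).

(** exp (y_1 Z) ... exp (y_n Z) = exp ((y_1 + ... + y_n) Z); the truncation does
not affect the degrees up to N. *)
Lemma coef_prod_divided_exp (F : fieldType) (A : comAlgType F) n
    (y : 'I_n -> A) N k :
  [pchar F] =i pred0 -> (k <= N)%N ->
  (\prod_(i < n) divided_exp N (y i))`_k =
  (k`!%:R : F)^-1 *: (\sum_(i < n) y i) ^+ k.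
Proof.
move=> F0; elim: n y k => [|n IHn] y k le_kN.
  rewrite !big_ord0 coef1 expr0n; case: k le_kN => [|k] _ //=.
    by rewrite fact0 invr1 scale1r.
  by rewrite scaler0.
rewrite !big_ord_recr divided_powerD //= coefM; apply: eq_bigr => i _.
have le_ik : (i <= k)%N by rewrite -ltnS.
rewrite IHn ?(leq_trans le_ik) // coef_poly ltnS.
by rewrite (leq_trans (leq_subr _ _)).
Qed.

(** Expanding the product of truncated exponentials over all choices of one
monomial in each factor produces the terms of the right-hand side divided by
k!, sorted by the power of Z. *)
Lemma multinomial_theorem (F : fieldType) (A : comAlgType F) n
    (y : 'I_n -> A) N k :
  [pchar F] =i pred0 -> (k <= N)%N ->
  (\sum_(i < n) y i) ^+ k =
  \sum_(t : {ffun 'I_n -> 'I_N.+1} | (\sum_(i < n) t i)%N == k)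
     (k`!%:R / (\prod_(i < n) (t i)`!)%N%:R : F) *: \prod_(i < n) y i ^+ t i.
Proof.
move=> F0 le_kN; have fact_neq0 m : (m`!%:R : F) != 0.
  by move/pcharf0P: F0 => ->; rewrite -lt0n fact_gt0.
apply: (@scalerI _ _ (k`!%:R : F)^-1); first by rewrite invr_eq0.
rewrite -(coef_prod_divided_exp _ F0 le_kN) scaler_sumr.
transitivity ((\sum_(t : {ffun 'I_n -> 'I_N.+1})
    (\prod_(i < n) ((t i)`!%:R : F)^-1 *: \prod_(i < n) y i ^+ t i) *:
       'X^(\sum_(i < n) t i))`_k).
  under eq_bigr do rewrite /divided_exp poly_def.
  rewrite bigA_distr_bigA !coef_sum; apply: eq_bigr => t _.
  by congr (_`_k); rewrite !scaler_prod -(big_morph _ (exprD 'X) (expr0 'X)).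
rewrite coef_sum [RHS]big_mkcond; apply: eq_bigr => t _.
rewrite coefZ coefXn eq_sym; case: eqP => [<-|_]; last by rewrite mulr0.
by rewrite mulr1 scalerA mulKf // natr_prod -prodfV.
Qed.

(** The parts of size i contribute a_i X^i, so a tuple t with
t_1 + 2 t_2 + ... + n t_n = n gives a term of degree n in the multinomial
expansion of the power with exponent k = t_1 + ... + t_n; such a k is at most
n. *)
Lemma multinomial_sumE (F : fieldType) (a : nat -> F) n :
  [pchar F] =i pred0 ->
  multinomial_sum n a = \sum_(k < n.+1) (-1) ^+ k * (pos_poly n a ^+ k)`_n.
Proof.
move=> F0.
have wt (t : {ffun 'I_n -> 'I_n.+1}) :
    (\sum_(i < n) t i <= \sum_(i < n) i.+1 * t i)%N.
  by apply: leq_sum => i _; rewrite leq_pmull.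
rewrite /multinomial_sum (partition_big (fun t : {ffun 'I_n -> 'I_n.+1} =>
   inord (\sum_(i < n) t i)%N : 'I_n.+1) xpredT) //=.
apply: eq_bigr => k _; have le_kn : (k <= n)%N by rewrite -ltnS.
rewrite (multinomial_theorem _ F0 le_kn) coef_sum mulr_sumr.
rewrite big_mkcond [RHS]big_mkcond; apply: eq_bigr => t _.
have -> : \prod_(i < n) (a i.+1 *: 'X^(i.+1)) ^+ t i =
    (\prod_(i < n) a i.+1 ^+ t i) *: 'X^(\sum_(i < n) i.+1 * t i) :> {poly F}.
  rewrite (big_morph _ (exprD 'X) (expr0 'X)) -scaler_prod.
  by apply: eq_bigr => i _; rewrite exprZn exprM.
rewrite !coefZ coefXn eq_sym; case: eqP => [eq_n|_] /=; last first.
  by rewrite !mulr0; case: ifP.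
have lt_tn : (\sum_(i < n) t i < n.+1)%N.
  by rewrite ltnS (leq_trans (wt t)) // -eq_n.
rewrite -val_eqE /= inordK //; case: eqP => // ->.
by rewrite mulr1 mulrCA mulrA.
Qed.

Lemma multinomial_composition (F : fieldType) (a : nat -> F) n :
  [pchar F] =i pred0 -> (1 <= n)%N -> multinomial_sum n a = composition_sum n a.
Proof. by move=> F0 n_gt0; rewrite composition_sumE // multinomial_sumE. Qed.

(** * Euler's continued fraction *)

(** The partial sum of degree m of the series
1 + (h_k / g_k) x + (h_k h_(k+1) / (g_k g_(k+1))) x^2 + ..., the analogue of
the series of the H_j / G_j for the sequences g and h started at index k. *)
Definition Euler_poly (F : fieldType) (g h : nat -> F) k m : {poly F} :=
  \poly_(j < m.+1) (\prod_(k <= i < k + j) (h i / g i)).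

Lemma Euler_poly0 (F : fieldType) (g h : nat -> F) k : Euler_poly g h k 0 = 1.
Proof.
by rewrite /Euler_poly poly_def big_ord1 addn0 big_geq // scale1r.
Qed.

Lemma Euler_polyS (F : fieldType) (g h : nat -> F) k m :
  Euler_poly g h k m.+1 = 1 + (h k / g k) *: 'X * Euler_poly g h k.+1 m.
Proof.
rewrite /Euler_poly !poly_def big_ord_recl /= addn0 big_geq // scale1r.
congr (_ + _); rewrite mulr_sumr; apply: eq_bigr => i _.
rewrite /bump leq0n add1n addnS big_ltn ?ltnS ?leq_addr //.
by rewrite -scalerAl -scalerAr scalerA -exprS addSn.
Qed.

(** The recursion in the form needed below: it turns the numerator h_k X of the
continued fraction, times the denominator of its tail, into a difference. *)
Lemma Euler_poly_numerator (F : fieldType) (g h : nat -> F) k m : g k != 0 ->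
  h k *: 'X * Euler_poly g h k.+1 m = g k *: (Euler_poly g h k m.+1 - 1).
Proof.
move=> gk0; rewrite Euler_polyS addrC addKr -!scalerAl scalerA mulrCA.
by rewrite mulfV ?mulr1.
Qed.

Lemma Euler_poly_at0 (F : fieldType) (g h : nat -> F) k m :
  (Euler_poly g h k m).[0] = 1.
Proof. by rewrite horner_coef0 coef_poly addn0 big_geq. Qed.

Lemma Euler_poly_neq0 (F : fieldType) (g h : nat -> F) k m :
  Euler_poly g h k m != 0.
Proof.
apply/eqP => E0; have := Euler_poly_at0 g h k m.
by rewrite E0 horner0 => /eqP; rewrite eq_sym oner_eq0.
Qed.

(** Euler's continued fraction. Let P be the partial sum starting at k + 1. With
the formula for the tail that starts at k + 1, the subtracted fraction becomes
g_k (P - 1) / P, by Euler_poly_numerator. What remains is h_k X + g_k / P, which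
is g_k times the partial sum starting at k, over P. *)
Lemma cf_tailE (F : fieldType) (g h : nat -> F) k m :
  (forall n, (k <= n)%N -> g n != 0) ->
  cf_tail g h k m =
    (g k *: Euler_poly g h k m.+1)%:F / (Euler_poly g h k.+1 m)%:F.
Proof.
elim: m k => [|m IHm] k g_neq0.
  rewrite /= Euler_polyS !Euler_poly0 mulr1 tofrac1 divr1 /partial_denominator.
  by rewrite scalerDr scalerA mulrCA mulfV ?g_neq0 // mulr1 alg_polyC.
rewrite -[LHS]/(partial_denominator g h k
  - ((g k * h k.+1) *: 'X)%:F / cf_tail g h k.+1 m).
rewrite IHm; last by move=> n /ltnW/g_neq0.
set P := Euler_poly g h k.+1 m.+1; set Q := Euler_poly g h k.+2 m.
have P0 : P%:F != 0 by rewrite tofrac_eq0 Euler_poly_neq0.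
have eqP_Q : h k.+1 *: 'X * Q = g k.+1 *: (P - 1).
  by rewrite Euler_poly_numerator ?g_neq0.
have gP0 : (g k.+1 *: P)%:F != 0.
  by rewrite tofrac_eq0 scaler_eq0 negb_or g_neq0 ?Euler_poly_neq0 /=.
apply: (mulIf P0); rewrite (mulfVK P0) mulrBl -tofracM.
rewrite invf_div mulrA -tofracM -scalerA -scalerAl eqP_Q.
(* Products of fractions are compared after clearing the denominator. *)
have -> : (g k *: (g k.+1 *: (P - 1)))%:F / (g k.+1 *: P)%:F * P%:F
        = (g k *: (P - 1))%:F.
  apply: (mulIf gP0); rewrite mulrAC (mulfVK gP0) -!tofracM; congr _%:F.
  by rewrite -!scalerAl -!scalerAr !scalerA.
rewrite -tofracB; congr _%:F; rewrite [in RHS]Euler_polyS -/P.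
rewrite mulrDl mul_polyC scalerBr opprB addrC addrA subrK alg_polyC.
by rewrite -!scalerAl scalerDr scalerA mulrCA mulfV ?g_neq0 // mulr1 alg_polyC.
Qed.

Lemma cf_truncationE (F : fieldType) (g h : nat -> F) n :
  (forall n, (1 <= n)%N -> g n != 0) -> (1 <= n)%N ->
  cf_truncation g h n = 1 / (Euler_poly g h 1 n)%:F.
Proof.
case: n => // n g_neq0 _; rewrite /cf_truncation succnK cf_tailE //.
set P := Euler_poly g h 1 n.+1; set Q := Euler_poly g h 2 n.
have P0 : P%:F != 0 by rewrite tofrac_eq0 Euler_poly_neq0.
have gP0 : (g 1%N *: P)%:F != 0.
  by rewrite tofrac_eq0 scaler_eq0 negb_or g_neq0 ?Euler_poly_neq0.
apply: (mulIf P0); rewrite (mulfVK P0) mulrBl mul1r invf_div mulrA -tofracM.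
have -> : (h 1%N *: 'X) * Q = g 1%N *: (P - 1).
  by rewrite Euler_poly_numerator ?g_neq0.
have -> : (g 1%N *: (P - 1))%:F / (g 1%N *: P)%:F * P%:F = (P - 1)%:F.
  apply: (mulIf gP0); rewrite mulrAC (mulfVK gP0) -!tofracM; congr _%:F.
  by rewrite -scalerAl -scalerAr.
by rewrite -tofracB opprB addrCA subrr addr0 tofrac1.
Qed.

(** The n-th truncation is the inverse of the n-th partial sum E_n of u, and
1/E_n - 1/u = (u - E_n) / (E_n u), where u - E_n has no term of degree at
most n. *)
Lemma cf_value_inv (F : fieldType) (g h : nat -> F) :
  (forall n, (1 <= n)%N -> g n != 0) ->
  cf_value g h (FPS (fun j => prefix_prod h j / prefix_prod g j))^-1.
Proof.
move=> g_neq0; set u := FPS _; pose E n := fps_of_poly (Euler_poly g h 1 n).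
have coefE n j : (j <= n)%N -> E n j = u j.
  move=> le_jn; rewrite /= coef_poly ltnS le_jn add1n /prefix_prod.
  by rewrite -prodf_div.
have Uu : u \is a GRing.unit.
  by rewrite fps_unitE /= /prefix_prod !big_geq // divr1 oner_eq0.
have UE n : E n \is a GRing.unit by rewrite fps_unitE coefE // -fps_unitE.
exists (fun n => (E n)^-1) => [n n_gt0|N].
  exists 1, (Euler_poly g h 1 n); split.
  - by rewrite Euler_poly_at0 oner_eq0.
  - by rewrite tofrac1 cf_truncationE.
  - exact/esym/mul1r.
exists N => // n /= le_Nn.
exists (FPS (fun j => (u - E n) (j + N)%N) * (E n)^-1 * u^-1).
have -> : (E n)^-1 - u^-1 = (u - E n) * (E n)^-1 * u^-1.
  by rewrite mulrBl mulrV // mulrBl mul1r mulrAC mulrV // mul1r.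
rewrite !mulrA; congr (_ * _ * _); apply/fpsP => j.
rewrite fps_coefM -[LHS]/(u j - E n j).
have [lt_jN|le_Nj] := ltnP j N.
  rewrite coefE ?(leq_trans (ltnW lt_jN)) // subrr big1 // => i _.
  by rewrite /= coefXn ltn_eqF ?mul0r // (leq_ltn_trans (leq_ord i)).
have lt_Nj : (N < j.+1)%N by [].
rewrite (bigD1 (Ordinal lt_Nj)) //= coefXn eqxx mul1r subnK //.
rewrite big1 ?addr0 // => i.
by rewrite -val_eqE /= coefXn => /negbTE->; rewrite mul0r.
Qed.

(** * The equivalence *)

Theorem theorem1 (R : realType) (f g h : nat -> R[i])
    (f0 : f 0%N = 1) (g_neq0 : forall n : nat, (1 <= n)%N -> g n != 0) :
  let H := prefix_prod h in
  let G := prefix_prod g in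
  let u := fun j : nat => H j / G j in
  [<->
    (* (i) *)
    FPS f = (FPS u)^-1 /\ cf_value g h (FPS u)^-1;
    (* (ii) *)
    forall n : nat, (1 <= n)%N -> f n = (-1) ^+ n * TH_det n u;
    (* (iii) *)
    forall n : nat,
      \sum_(k < n.+1) f k * u (n - k)%N = if n == 0%N then 1 else 0;
    (* (iv) *)
    forall n : nat, (1 <= n)%N -> u n = (-1) ^+ n * TH_det n f;
    (* (v) *)
    forall n : nat, (1 <= n)%N ->
      f n = multinomial_sum n u /\ multinomial_sum n u = composition_sum n u;
    (* (vi) *)
    forall n : nat, (1 <= n)%N ->
      u n = multinomial_sum n f /\ multinomial_sum n f = composition_sum n f
  ].
Proof.
move=> H G u; have u0 : u 0%N = 1.
  by rewrite /u /H /G /prefix_prod !big_geq // divr1.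
have C0 := Num.Theory.pchar_num R[i].
have sumP (a b : nat -> R[i]) : a 0%N = 1 -> b 0%N = 1 ->
    FPS b = (FPS a)^-1 <-> (forall n, (1 <= n)%N ->
      b n = multinomial_sum n a /\ multinomial_sum n a = composition_sum n a).
  move=> a0 b0.
  have inv_a n (n_gt0 : (1 <= n)%N) := fps_inv_composition a0 n_gt0.
  rewrite (fps_eq_invP a0 b0 inv_a); split=> eq_b n n_gt0.
    by rewrite multinomial_composition // eq_b.
  by case: (eq_b n n_gt0) => ->.
have detP (a b : nat -> R[i]) (a0 : a 0%N = 1) (b0 : b 0%N = 1) :=
  fps_eq_invP a0 b0 (fun n _ => fps_inv_TH_det n a0).
have ii := detP _ _ u0 f0; have v := sumP _ _ u0 f0.
have iv := iff_trans (fps_inv_sym _ _) (detP _ _ f0 u0).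
have vi := iff_trans (fps_inv_sym _ _) (sumP _ _ f0 u0).
have iii := fps_invP f u0.
tfae=> [[/ii] | /ii/iii | /iii/iv | /iv/v | /v/vi | /vi eq_f] //.
by split=> //; exact: cf_value_inv.
Qed.
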